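(* Let $E$, $F$, and $X$ be locally convex spaces, $\ell\in\mathbb{N}_0\cup\{\infty\}$, and $R\subseteq X$ be a regular subset. Let $\gamma\colon R\to\mathcal{L}(E,F)$ be a $C^\ell$-map to the space of continuous linear operators, endowed with the compact-open topology. Let $\eta\colon R\to E$ be a $C^\ell$-map. If $R\times X$ is a $k_{\mathbb{R}}$-space, then $$R\to F,\quad x\mapsto\gamma(x)(\eta(x))$$ is a $C^\ell$-map.
   Context: ''Locally convex space'' means a real, Hausdorff locally convex topological vector space. A subset $R$ of a topological space is regular if its interior $R^0$ is dense in $R$. For locally convex spaces $X,Y$ and a regular subset $R\subseteq X$, a map $f\colon R\to Y$ is $C^\ell$ if it is continuous and for all $j\in\mathbb{N}$ with $j\le\ell$ the iterated directional derivatives $d^{(j)}f(x,y_1,\ldots,y_j)=(D_{y_j}\cdots D_{y_1}f)(x)$ exist for all $x\in R^0$, $y_1,\ldots,y_j\in X$, and the function so obtained extends to a continuous map $R\times X^j\to Y$ ($C^0$ means continuous). A Hausdorff topological space $Z$ is a $k_{\mathbb{R}}$-space if a function $f\colon Z\to\mathbb{R}$ is continuous whenever $f|_K$ is continuous for each compact subset $K\subseteq Z$. $\mathcal{L}(E,F)$ is the vector space of continuous linear maps $E\to F$. *)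

(* Defs.v *)
From HB Require Import structures.
From mathcomp Require Import all_boot all_order all_algebra.
From mathcomp Require Import all_classical all_reals all_analysis.

Set Implicit Arguments.
Unset Strict Implicit.
Unset Printing Implicit Defensive.

Import Order.TTheory GRing.Theory Num.Theory.
Import numFieldNormedType.Exports.

Local Open Scope classical_set_scope.
Local Open Scope ring_scope.

(* A Hausdorff locally convex space is a [tvsType R] together with
   [hausdorff_space]; the separation axiom is not part of [tvsType]. *)

Section ContinuousLinearMaps.
Context {R : realType} (E F : tvsType R).

Definition cont_linear : {pred E -> F} :=
  mem [set f : E -> F | linear f /\ continuous f].

Record cont_linear_map := ContLinearMap {
  cont_linear_fun :> E -> F;
  _ : cont_linear_fun \in cont_linear }.

HB.instance Definition _ := [isSub for cont_linear_fun].
HB.instance Definition _ := [Choice of cont_linear_map by <:].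

Lemma cont_linear_submod_closed : submod_closed cont_linear.
Proof.
split=> [|a f g].
  rewrite inE; split=> [k x y|]; first by rewrite /= scaler0 addr0.
  exact: cst_continuous.
rewrite !inE => -[lf cf] [lg cg]; split=> [k x y|x].
  rewrite /= -[LHS]/(a *: f (k *: x + y) + g (k *: x + y)) lf lg.
  by rewrite [RHS]/(k *: (a *: f x + g x) + (a *: f y + g y)) !scalerDr
    !scalerA mulrC addrACA.
apply: (@continuous_comp _ _ _ (fun z => (a *: f z, g z))
  (fun z : F * F => z.1 + z.2)); last exact: add_continuous.
apply: cvg_pair; last exact: cg.
apply: (@continuous_comp _ _ _ (fun z => (a, f z))
  (fun z : R^o * F => z.1 *: z.2)); last exact: scale_continuous.
by apply: (@cvg_pair _ _ _ _ (nbhs (a : R^o))); [exact: cvg_cst|exact: cf].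
Qed.

HB.instance Definition _ :=
  GRing.isSubmodClosed.Build R (E -> F) cont_linear cont_linear_submod_closed.
HB.instance Definition _ := [SubChoice_isSubLmodule of cont_linear_map by <:].

HB.instance Definition _ := Topological.copy cont_linear_map
  (initial_topology (cont_linear_fun : cont_linear_map -> {compact-open, E -> F})).

End ContinuousLinearMaps.

Section Smooth.
Context {R : realType} {X : tvsType R}.

Definition regular_set (A : set X) := A `<=` closure A°.

(* The codomain [Y] only carries a topology and a linear structure here, so
   that [C_map] applies to [cont_linear_map E F] without rebuilding its
   locally convex structure. *)
Context {Y : preTopologicalLmodType R}.

Definition is_dir_derive (f : X -> Y) (v x : X) (l : Y) :=
  h^-1 *: (f (h *: v + x) - f x) @[h --> 0^'] --> l.

(* [derive] is restricted to normed spaces in the library. *)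
Definition dir_derive (f : X -> Y) (v x : X) : Y :=
  xget 0 [set l | is_dir_derive f v x l].

(* For [ys = [:: y_1; ..; y_j]] this is $D_{y_j} \cdots D_{y_1} f$. *)
Definition iter_dir_derive (f : X -> Y) (ys : seq X) : X -> Y :=
  foldl dir_derive f ys.

Fixpoint iter_dir_derivable (U : set X) (f : X -> Y) (ys : seq X) : Prop :=
  if ys is y :: ys' then
    (forall x, U x -> exists l, is_dir_derive f y x l)
    /\ iter_dir_derivable U (dir_derive f y) ys'
  else True.

(* [ell = None] stands for $\ell = \infty$. *)
Definition le_order (j : nat) (ell : option nat) : bool :=
  if ell is Some n then (j <= n)%N else true.

(* A map $A \to Y$ is represented by a total function whose values outside
   [A] are irrelevant: the derivatives are only taken on the open set [A°]. *)
Definition C_map (ell : option nat) (A : set X) (f : X -> Y) : Prop :=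
  {within A, continuous f} /\
  forall j : nat, le_order j ell ->
    (forall y : 'I_j -> X, iter_dir_derivable A° f (codom y)) /\
    exists g : X * {ptws 'I_j -> X} -> Y,
      {within A `*` [set: {ptws 'I_j -> X}], continuous g} /\
      forall (x : X) (y : 'I_j -> X), A° x ->
        g (x, y) = iter_dir_derive f (codom y) x.

End Smooth.

Definition kR_space (R : realType) (Z : topologicalType) : Prop :=
  hausdorff_space Z /\
  forall f : Z -> R,
    (forall K : set Z, compact K -> {within K, continuous f}) -> continuous f.

(* Main.v *)
(* On the interior of [A] the Leibniz rule holds in spite of the discontinuity
   of evaluation [L(E, F) x E -> F], because evaluation is continuous along
   arguments staying in a compact set.  Hence the [j]-th derivative is a sum of
   terms [G(x, y_I)(H(x, y_J))], which are continuous on compact sets.  The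
   [k_R]-hypothesis concerns [A x X] only, so it gives continuity merely of the
   diagonal [(x, v) |-> d^(j) f(x, v, .., v)]; the full derivative is recovered
   from the diagonal by polarization.  Instead of proving that [d^(j) f(x, .)] is
   symmetric and multilinear, polarization is read off from iterated difference
   quotients, whose convergence follows from a mean value theorem for open
   convex sets. *)
Require Import Defs.
From HB Require Import structures.
From mathcomp Require Import all_boot all_order all_algebra.
From mathcomp Require Import all_classical all_reals all_analysis.

Import Order.TTheory GRing.Theory Num.Theory.
Import numFieldNormedType.Exports.

Local Open Scope classical_set_scope.
Local Open Scope ring_scope.

Set Implicit Arguments.
Unset Strict Implicit.
Unset Printing Implicit Defensive.

(** * Limits and convex neighbourhoods in topological vector spaces *)

Section TvsLimits.
Context {R : realType} {V : tvsType R}.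

Lemma tvs_cvgD {T : Type} {Fil : set_system T} {FF : Filter Fil}
    (f g : T -> V) (a b : V) :
  f @ Fil --> a -> g @ Fil --> b -> (fun t => f t + g t) @ Fil --> a + b.
Proof.
by apply: (@continuous2_cvg _ _ _ _ _ _ _ _ (fun x y => x + y));
  exact: (@add_continuous V (a, b)).
Qed.

Lemma tvs_cvgZ {T : Type} {Fil : set_system T} {FF : Filter Fil}
    (k : T -> R) (f : T -> V) (l : R) (a : V) :
  k @ Fil --> l -> f @ Fil --> a -> (fun t => k t *: f t) @ Fil --> l *: a.
Proof.
by apply: (@continuous2_cvg _ R^o V V _ _ _ _ (fun x y => x *: y));
  exact: (@scale_continuous R V (l, a)).
Qed.

Lemma tvs_cvgZl {T : Type} {Fil : set_system T} {FF : Filter Fil}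
    (k : R) (f : T -> V) (a : V) :
  f @ Fil --> a -> (fun t => k *: f t) @ Fil --> k *: a.
Proof. by move=> fa; apply: tvs_cvgZ fa; exact: cvg_cst. Qed.

Lemma tvs_cvgB {T : Type} {Fil : set_system T} {FF : Filter Fil}
    (f g : T -> V) (a b : V) :
  f @ Fil --> a -> g @ Fil --> b -> (fun t => f t - g t) @ Fil --> a - b.
Proof.
move=> fa gb; apply: tvs_cvgD => //.
by rewrite -scaleN1r; under eq_fun do rewrite -scaleN1r; exact: tvs_cvgZl.
Qed.

Lemma tvs_cvg_sum {T : Type} {Fil : set_system T} {FF : Filter Fil}
    (I : Type) (r : seq I) (f : I -> T -> V) (a : I -> V) :
  (forall i, f i @ Fil --> a i) ->
  (fun t => \sum_(i <- r) f i t) @ Fil --> \sum_(i <- r) a i.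
Proof.
move=> fa; elim: r => [|i r IH].
  by rewrite big_nil; under eq_fun do rewrite big_nil; exact: cvg_cst.
by rewrite big_cons; under eq_fun do rewrite big_cons; exact: tvs_cvgD.
Qed.

Lemma cvg_line (v x : V) : h *: v + x @[h --> (0 : R)] --> x.
Proof.
rewrite -{2}[x]add0r -(scale0r v); apply: tvs_cvgD; last exact: cvg_cst.
by apply: tvs_cvgZ; [exact: cvg_id|exact: cvg_cst].
Qed.

Lemma line_continuous (v x : V) : continuous (fun h : R => h *: v + x).
Proof.
move=> s; apply: tvs_cvgD; last exact: cvg_cst.
by apply: tvs_cvgZ; [exact: cvg_id|exact: cvg_cst].
Qed.

Definition is_convex (C : set V) := forall a b (s : R),
  C a -> C b -> 0 <= s <= 1 -> C (s *: a + (1 - s) *: b).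

Lemma nbhs_open_convex (x : V) (W : set V) : nbhs x W ->
  exists C, [/\ open C, is_convex C, C x & C `<=` W].
Proof.
have [B Bconv [Bopen Bnbhs]] := @locally_convex R V.
move=> /(Bnbhs x)[C [BC Cx] CW]; exists C; split => //; first exact: Bopen.
move=> a b s Ca Cb /andP[s0 s1].
have := Bconv C (mem_set BC) a b (Itv01 s0 s1) (mem_set Ca) (mem_set Cb).
by rewrite inE.
Qed.

End TvsLimits.

(** * Mean value theorem for curves *)

Section MeanValue.
Context {R : realType} {V : tvsType R}.

(* The set of [s] whose difference quotient lies in [C] is closed under left
   limits and open to the right, because quotients over adjacent intervals
   combine convexly; so it contains its supremum, which must be [t]. *)
Lemma mean_value_convex (phi dphi : R -> V) (C : set V) (t : R) :
    0 < t -> open C -> is_convex C ->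
    (forall s, 0 <= s <= t ->
      h^-1 *: (phi (h + s) - phi s) @[h --> 0^'] --> dphi s /\ C (dphi s)) ->
  C (t^-1 *: (phi t - phi 0)).
Proof.
move=> t0 oC cC hphi.
(* [Q a b] is void for [b <= a], so [Q 0 0] costs nothing. *)
pose Q (a b : R) := a < b -> C ((b - a)^-1 *: (phi b - phi a)).
have Qtrans a b c : a <= b <= c -> Q a b -> Q b c -> Q a c.
  move=> /andP[]; rewrite le_eqVlt => /predU1P[<- //|ab].
  rewrite le_eqVlt => /predU1P[<- //|bc] /(_ ab) Qab /(_ bc) Qbc ac.
  have ca : c - a != 0 by rewrite subr_eq0 gt_eqF.
  have ba : b - a != 0 by rewrite subr_eq0 gt_eqF.
  have cb : c - b != 0 by rewrite subr_eq0 gt_eqF.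
  have := cC _ _ ((b - a) / (c - a)) Qab Qbc.
  have -> : 1 - (b - a) / (c - a) = (c - b) / (c - a).
    by rewrite -{1}(divff ca) -mulrBl opprB addrA subrK.
  rewrite !scalerA ![_ / (c - a)]mulrC -!mulrA !divff// !mulr1 -scalerDr.
  rewrite [phi b - _ + _]addrC addrA subrK; apply.
  have ac0 : 0 < c - a by rewrite subr_gt0.
  rewrite [_^-1 * _]mulrC divr_ge0 ?subr_ge0 ?(ltW ab) ?(ltW ac)//=.
  by rewrite ler_pdivrMr ?subr_gt0// mul1r lerD2r ltW.
have loc c : 0 <= c <= t -> exists2 d, 0 < d & forall h, 0 < `|h| < d ->
    C (h^-1 *: (phi (h + c) - phi c)).
  move=> /hphi[+ Cc] => /(_ C) /=; rewrite nbhs_filterE => /(_ _)[].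
    exact: open_nbhs_nbhs.
  move=> d /= d0 dC; exists d => // h /andP[h0 hd].
  apply: dC; last by rewrite -normr_gt0.
  by rewrite /= sub0r normrN.
pose S := [set s | 0 <= s <= t /\ Q 0 s].
have S0 : S 0 by split; rewrite ?lexx ?ltW// /Q ltxx.
have hS : has_sup S.
  by split; [exists 0|exists t => s [/andP[]]].
have c0t : 0 <= sup S <= t.
  rewrite ub_le_sup//=; last by case: hS.
  by apply: ge_sup; [exists 0|move=> s [/andP[]]].
set c := sup S in c0t *.
have [d d0 dC] := loc _ c0t.
have Qc : Q 0 c.
  have [s Ss] := sup_adherent d0 hS; rewrite -/c => cds.
  have sc : s <= c by apply: ub_le_sup => //; case: hS.
  case: Ss => /andP[s0 st] Q0s; apply: (Qtrans _ s) => //; first by rewrite s0.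
  (* The quotient over [[s, c]] is the difference quotient at [c] with negative step [s - c]. *)
  rewrite /Q => slc; rewrite -[_ - _]opprK invrN scaleNr -scalerN !opprB.
  have := dC (s - c); rewrite subrK; apply.
  rewrite normr_gt0 subr_eq0 (lt_eqF slc) /= distrC gtr0_norm ?subr_gt0//.
  by rewrite ltrBlDr addrC -ltrBlDr.
suff ct : c = t by move: Qc; rewrite ct /Q => /(_ t0); rewrite subr0.
apply/eqP; rewrite eq_le; case/andP: c0t => c0 ctle; rewrite ctle /=.
rewrite leNgt; apply/negP => ct.
(* Halving [d] makes [h] small enough for [dC]; the cap [t - c] keeps [h + c] in [[0, t]]. *)
pose h := Num.min (d / 2) (t - c).
have h0 : 0 < h by rewrite lt_min subr_gt0 ct divr_gt0.
have : S (h + c).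
  split.
    by rewrite addr_ge0 ?(ltW h0)//= -lerBrDr ge_min lexx orbT.
  apply: (Qtrans _ c) => //; first by rewrite c0 lerDr ltW.
  move=> _; rewrite addrK; apply: dC.
  rewrite gtr0_norm// h0 /= gt_min; apply/orP; left.
  by rewrite ltr_pdivrMr// ltr_pMr// ltr1n.
move=> /(ub_le_sup hS.2); rewrite -/c.
by rewrite gerDr leNgt h0.
Qed.

End MeanValue.

(** * Evaluation of operators in the compact-open topology *)

Section Evaluation.
Context {R : realType} {E F : tvsType R}.

Lemma cont_linear_mapP (g : cont_linear_map E F) :
  linear (g : E -> F) /\ continuous (g : E -> F).
Proof. by case: g => g /=; rewrite inE. Qed.

(* The compact-open topology makes evaluation continuous along arguments that
   stay in a compact set: replace the image by its intersection with the
   preimage under [g0] of a closed neighbourhood of [g0 e0]. *)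
Lemma cvg_eval {T : Type} {Fil : set_system T} {FF : Filter Fil}
    (g : T -> cont_linear_map E F) (e : T -> E) (g0 : cont_linear_map E F)
    (e0 : E) (K : set E) :
  compact K -> g @ Fil --> g0 -> e @ Fil --> e0 ->
  (\forall t \near Fil, K (e t)) -> (fun t => g t (e t)) @ Fil --> g0 (e0).
Proof.
move=> cK gg0 ee0 Ke O /=; rewrite nbhsE => -[P [oP Pg] PO].
have [W nW clW] := @uniform_regular F (g0 e0) P (open_nbhs_nbhs (conj oP Pg)).
pose K' := K `&` [set x | closure W (g0 x)].
have cg0 := (cont_linear_mapP g0).2.
have cK' : compact K'.
  apply: compact_closedI => //.
  exact: (closed_comp (fun x _ => cg0 x) (@closed_closure _ W)).
have nG : nbhs g0 [set f : cont_linear_map E F | (f : E -> F) @` K' `<=` P].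
  apply: open_nbhs_nbhs; split.
    exists [set f : {compact-open, E -> F} | f @` K' `<=` P] => //.
    exact: compact_open_open.
  by move=> _ [x [_ Wx] <-]; exact: clW.
have nE : nbhs e0 [set x | W (g0 x)] by exact: cg0.
rewrite nbhs_filterE /=.
near=> t; apply: PO.
suff sub : (g t : E -> F) @` K' `<=` P.
  apply: sub; exists (e t) => //.
  split; first by near: t.
  by apply: subset_closure; near: t; exact: (ee0 _ nE).
by near: t; exact: (gg0 _ nG).
Unshelve. all: by end_near. Qed.

End Evaluation.

(** * Directional derivatives and the Leibniz rule *)

Section DirectionalDerivative.
Context {R : realType} {X : tvsType R}.

Lemma near_line (U : set X) (v x : X) : open U -> U x ->
  \forall h \near (0 : R), U (h *: v + x).
Proof. by move=> oU Ux; exact: cvg_line (open_nbhs_nbhs (conj oU Ux)). Qed.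

Section PreTopological.
Context {Y : preTopologicalLmodType R}.
Implicit Types (f g : X -> Y) (v x : X) (U : set X) (ys : seq X).

Lemma dir_deriveE f v x l : hausdorff_space Y ->
  is_dir_derive f v x l -> dir_derive f v x = l.
Proof.
move=> hY fl; apply: xget_unique => // l' fl'.
exact: (cvg_unique hY fl' fl).
Qed.

Lemma dir_deriveP f v x :
  (exists l, is_dir_derive f v x l) -> is_dir_derive f v x (dir_derive f v x).
Proof. exact: xgetPex. Qed.

(** Difference quotients at [x] only see [f] near [x]. Identities between derivatives hold on [U]
    only, and this locality carries them through further differentiation. *)
Lemma is_dir_derive_eq_on U f g v x l : open U -> U x ->
  (forall z, U z -> f z = g z) -> is_dir_derive f v x l -> is_dir_derive g v x l.
Proof.
move=> oU Ux fg; apply: cvg_trans; apply: near_eq_cvg.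
have := near_line v oU Ux => /nbhs_dnbhs.
by apply: filterS => h Uh; rewrite !fg.
Qed.

Lemma dir_derive_eq_on U f g v : open U ->
  (forall z, U z -> f z = g z) ->
  forall z, U z -> dir_derive f v z = dir_derive g v z.
Proof.
move=> oU fg z Uz; congr xget; apply/seteqP; split => l /=.
  exact: (is_dir_derive_eq_on oU Uz fg).
by apply: (is_dir_derive_eq_on oU Uz) => w Uw; rewrite fg.
Qed.

Lemma iter_dir_derive_eq_on U f g ys : open U ->
  (forall z, U z -> f z = g z) ->
  forall z, U z -> iter_dir_derive f ys z = iter_dir_derive g ys z.
Proof.
move=> oU; elim: ys f g => [//|y ys IH] f g fg; apply: IH.
exact: dir_derive_eq_on.
Qed.

Lemma iter_dir_derivable_eq_on U f g ys : open U ->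
  (forall z, U z -> f z = g z) ->
  iter_dir_derivable U f ys -> iter_dir_derivable U g ys.
Proof.
move=> oU; elim: ys f g => [//|y ys IH] f g fg /= [ex df]; split.
  by move=> x Ux; have [l fl] := ex x Ux; exists l; exact: (is_dir_derive_eq_on oU Ux fg fl).
by apply: IH df; exact: dir_derive_eq_on.
Qed.

Lemma iter_dir_derive_rcons f ys y :
  iter_dir_derive f (rcons ys y) = dir_derive (iter_dir_derive f ys) y.
Proof. exact: foldl_rcons. Qed.

(* The part of [C_map n] that lives on the open set [U], with continuity of
   the derivatives in the base point only. *)
Definition smooth_on U (n : nat) f := forall zs : seq X, (size zs <= n)%N ->
  iter_dir_derivable U f zs /\
  (forall x, U x -> {for x, continuous (iter_dir_derive f zs)}).

Lemma smooth_onS U n f y : smooth_on U n.+1 f -> smooth_on U n (dir_derive f y).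
Proof. by move=> sf zs szs; have [[_ ?] ?] := sf (y :: zs) szs. Qed.

Lemma smooth_on_le U m n f : (m <= n)%N -> smooth_on U n f -> smooth_on U m f.
Proof. by move=> mn sf zs szs; apply: sf; exact: leq_trans mn. Qed.

Lemma smooth_on_ex U n f y x : smooth_on U n.+1 f -> U x ->
  is_dir_derive f y x (dir_derive f y x).
Proof.
by move=> sf Ux; have [[/(_ x Ux) ? _] _] := sf [:: y] isT; exact: dir_deriveP.
Qed.

Lemma smooth_on_continuous U n f x : smooth_on U n f -> U x ->
  {for x, continuous f}.
Proof. by move=> sf Ux; have [_] := sf [::] isT; exact. Qed.

End PreTopological.

Section Tvs.
Context {V : tvsType R}.
Implicit Types (f g : X -> V).

Lemma is_dir_deriveD f g v x l m :
  is_dir_derive f v x l -> is_dir_derive g v x m ->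
  is_dir_derive (fun z => f z + g z) v x (l + m).
Proof.
move=> fl gm; apply: cvg_trans (tvs_cvgD fl gm).
apply: near_eq_cvg; apply: filterE => h /=.
by rewrite -scalerDr addrACA -opprD.
Qed.

Lemma is_dir_deriveB f g v x l m :
  is_dir_derive f v x l -> is_dir_derive g v x m ->
  is_dir_derive (fun z => f z - g z) v x (l - m).
Proof.
move=> fl gm; apply: cvg_trans (tvs_cvgB fl gm).
apply: near_eq_cvg; apply: filterE => h /=.
rewrite -scalerBr !opprB; congr (_ *: _).
by rewrite [LHS]addrACA [RHS]addrACA; congr (_ + _); rewrite addrC.
Qed.

Lemma iter_dir_deriveD (U : set X) f g ys : hausdorff_space V -> open U ->
  iter_dir_derivable U f ys -> iter_dir_derivable U g ys ->
  iter_dir_derivable U (fun z => f z + g z) ys /\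
  forall x, U x -> iter_dir_derive (fun z => f z + g z) ys x =
                   iter_dir_derive f ys x + iter_dir_derive g ys x.
Proof.
move=> hV oU; elim: ys f g => [//|y ys IH] f g /= [exf df] [exg dg].
have dfg z : U z -> is_dir_derive (fun z => f z + g z) y z
    (dir_derive f y z + dir_derive g y z).
  by move=> Uz; apply: is_dir_deriveD; apply: dir_deriveP; [exact: exf|exact: exg].
have dfgE z : U z -> dir_derive f y z + dir_derive g y z =
    dir_derive (fun z => f z + g z) y z.
  by move=> Uz; rewrite (dir_deriveE hV (dfg z Uz)).
have [IH1 IH2] := IH _ _ df dg; split.
  split; first by move=> x Ux; eexists; exact: dfg.
  exact: (iter_dir_derivable_eq_on oU dfgE IH1).
move=> x Ux; rewrite -[RHS]IH2//.
by apply/esym; exact: (iter_dir_derive_eq_on _ oU dfgE).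
Qed.

End Tvs.

Section Leibniz.
Context {E F : tvsType R}.
Implicit Types (g : X -> cont_linear_map E F) (e : X -> E).

(** The compact set that [cvg_eval] asks for is the image of [K] under [e]. *)
Lemma within_eval {T : topologicalType} (K : set T)
    (g : T -> cont_linear_map E F) (e : T -> E) :
  compact K -> {within K, continuous g} -> {within K, continuous e} ->
  {within K, continuous (fun t => g t (e t))}.
Proof.
move=> cK cg ce; apply/subspace_continuousP => x Kx.
apply: (@cvg_eval _ _ _ _ _ _ g e (g x) (e x) (e @` K)).
- exact: continuous_compact.
- by move/subspace_continuousP: cg; exact.
- by move/subspace_continuousP: ce; exact.
- by rewrite near_withinE; apply: filterE => t Kt; exists t.
Qed.

(** The quotient splits into the quotient of [g] applied to [e (h *: y + x)], plus [g x] applied to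
    the quotient of [e]. The latter converges by continuity of [g x], the former by [cvg_eval], its
    arguments running through a compact arc. *)
Lemma is_dir_derive_eval (U : set X) g e y x dg de : open U -> U x ->
  (forall z, U z -> {for z, continuous e}) ->
  is_dir_derive g y x dg -> is_dir_derive e y x de ->
  is_dir_derive (fun z => g z (e z)) y x (dg (e x) + g x de).
Proof.
move=> oU Ux ce hg he; rewrite /is_dir_derive /=.
have [lg cg] := cont_linear_mapP (g x).
pose lgx : {linear E -> F} := HB.pack (g x : E -> F)
  (GRing.isLinear.Build R E F *:%R (g x) lg).
have gZB (k : R) (a b : E) : g x (k *: (a - b)) = k *: (g x a - g x b).
  by rewrite -[LHS]/(lgx _) linearZ linearB.
suff : (fun h : R => (h^-1 *: (g (h *: y + x) - g x)) (e (h *: y + x)) +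
    g x (h^-1 *: (e (h *: y + x) - e x))) @ 0^' --> dg (e x) + g x de.
  apply: cvg_trans; apply: near_eq_cvg; apply: filterE => h /=.
  rewrite [X in X + _](_ : _ = h^-1 *: (g (h *: y + x) (e (h *: y + x)) -
    g x (e (h *: y + x))))//.
  rewrite gZB.
  by rewrite -scalerDr addrA subrK.
(* With [d / 2] the closed segment [I] lies inside [U]; its image under [e] is the compact arc. *)
have [d /= d0 dU] := near_line y oU Ux.
pose I := (fun h : R => h *: y + x) @` `[- (d / 2), d / 2].
have d20 : 0 < d / 2 by rewrite divr_gt0.
have IU : I `<=` U.
  move=> z [h /=]; rewrite in_itv /= -ler_norml => hd <-; apply: dU.
  rewrite /= sub0r normrN (le_lt_trans hd)// ltr_pdivrMr// ltr_pMr//.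
  by rewrite ltr1n.
have cI : compact I.
  apply: continuous_compact; last exact: segment_compact.
  exact/continuous_subspaceT/line_continuous.
apply: tvs_cvgD; last exact: (cvg_comp _ _ he (cg de)).
apply: (@cvg_eval _ _ _ _ _ _ (fun h : R => h^-1 *: (g (h *: y + x) - g x)) _
  _ _ (e @` I)) => //.
- apply: continuous_compact => //; apply: continuous_in_subspaceT => z.
  by rewrite inE => /IU; exact: ce.
- by apply: (cvg_comp _ _ _ (ce x Ux)) => W nW; exact: nbhs_dnbhs (cvg_line y nW).
- apply: nbhs_dnbhs; exists (d / 2) => //= h.
  rewrite /= sub0r normrN => hd; exists (h *: y + x) => //; exists h => //=.
  by rewrite in_itv /= -ler_norml ltW.
Qed.

(** The sum over all splittings of [ys] into two subsequences, one differentiating [g], the other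
    [e]. The recursion follows [iter_dir_derive] and avoids indexing by subsets. *)
Fixpoint leibniz_sum g e (ys : seq X) (x : X) : F :=
  if ys is y :: ys' then
    leibniz_sum (dir_derive g y) e ys' x + leibniz_sum g (dir_derive e y) ys' x
  else g x (e x).

(** One differentiation yields two products of the same shape, and the induction hypothesis applies
    to each. *)
Lemma leibniz (U : set X) ys g e :
  hausdorff_space F -> open U ->
  smooth_on U (size ys) g -> smooth_on U (size ys) e ->
  iter_dir_derivable U (fun z => g z (e z)) ys /\
  forall x, U x ->
    iter_dir_derive (fun z => g z (e z)) ys x = leibniz_sum g e ys x.
Proof.
move=> hF oU; elim: ys g e => [//|y ys IH] g e sg se.
have sg' := smooth_on_le (leqnSn _) sg; have se' := smooth_on_le (leqnSn _) se.
have dge z : U z -> is_dir_derive (fun z => g z (e z)) y z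
    (dir_derive g y z (e z) + g z (dir_derive e y z)).
  move=> Uz; apply: (is_dir_derive_eval oU) => //.
  - by move=> z' Uz'; exact: (smooth_on_continuous se).
  - exact: (smooth_on_ex sg Uz).
  - exact: (smooth_on_ex se Uz).
have dgeE z : U z -> dir_derive g y z (e z) + g z (dir_derive e y z) =
    dir_derive (fun z => g z (e z)) y z.
  by move=> Uz; rewrite (dir_deriveE hF (dge z Uz)).
have [d1 e1] := IH _ _ (smooth_onS y sg) se'.
have [d2 e2] := IH _ _ sg' (smooth_onS y se).
have [d12 e12] := iter_dir_deriveD hF oU d1 d2; split.
  split; first by move=> x Ux; eexists; exact: dge.
  exact: (iter_dir_derivable_eq_on oU dgeE d12).
move=> x Ux /=; rewrite -e1// -e2// -e12//.
by apply/esym; exact: (iter_dir_derive_eq_on _ oU dgeE).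
Qed.

Lemma leibniz_sum_continuous (U K : set X) ys g e :
  smooth_on U (size ys) g -> smooth_on U (size ys) e ->
  compact K -> K `<=` U -> {within K, continuous (leibniz_sum g e ys)}.
Proof.
move=> + + cK KU; elim: ys g e => [|y ys IH] g e sg se.
  apply: within_eval => //; apply: continuous_in_subspaceT => z;
    rewrite inE => /KU.
  - exact: (smooth_on_continuous sg).
  - exact: (smooth_on_continuous se).
have sg' := smooth_on_le (leqnSn _) sg; have se' := smooth_on_le (leqnSn _) se.
move=> z; apply: tvs_cvgD.
  by apply: IH => //; exact: smooth_onS.
by apply: IH => //; exact: smooth_onS.
Qed.

End Leibniz.

End DirectionalDerivative.

(** * Iterated finite differences *)

Section FiniteDifferences.

(** The iterated forward difference $\Delta_{h_1}\cdots\Delta_{h_n}f(x)$. *)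
Fixpoint diff {G H : zmodType} (hs : seq G) (f : G -> H) (x : G) : H :=
  if hs is h :: hs' then diff hs' f (h + x) - diff hs' f x else f x.

(** The indicator vectors of the subsets of an [n]-element set, which index the vertices in an
    [n]-fold difference. *)
Fixpoint masks (n : nat) : seq bitseq :=
  if n is n'.+1 then
    [seq true :: m | m <- masks n'] ++ [seq false :: m | m <- masks n']
  else [:: [::]].

Lemma diffE {R : pzRingType} {G : zmodType} {H : lmodType R} (hs : seq G)
    (f : G -> H) (x : G) :
  diff hs f x = \sum_(m <- masks (size hs))
    (-1) ^+ count negb m *: f (\sum_(y <- mask m hs) y + x).
Proof.
elim: hs x => [|h hs IH] x /=.
  by rewrite big_seq1 big_nil add0r expr0 scale1r.
rewrite big_cat !big_map /= !IH -sumrN; congr (_ + _); apply: eq_bigr => m _.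
  by rewrite big_cons addrA [h + _]addrC.
by rewrite add1n exprS mulN1r scaleNr.
Qed.

Lemma diff_sum {R : pzRingType} {G : zmodType} {H : lmodType R} (I : Type)
    (r : seq I) (c : I -> R) (f : I -> G -> H) (hs : seq G) (x : G) :
  diff hs (fun z => \sum_(i <- r) c i *: f i z) x =
  \sum_(i <- r) c i *: diff hs (f i) x.
Proof.
elim: hs x => [//|h hs IH] x /=; rewrite !IH -sumrB.
by apply: eq_bigr => i _; rewrite scalerBr.
Qed.

Lemma eq_diff {G H : zmodType} (hs : seq G) (f g : G -> H) (x : G) :
  f =1 g -> diff hs f x = diff hs g x.
Proof. by move=> fg; congr diff; exact/funext. Qed.

(** Difference operators commute, so the outermost one may act on [f] first. *)
Lemma diff_swap {G H : zmodType} (h : G) (hs : seq G) (f : G -> H) (x : G) :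
  diff (h :: hs) f x = diff hs (fun z => f (h + z) - f z) x.
Proof.
elim: hs x => [//|k hs IH] x.
have -> : diff (h :: k :: hs) f x = diff (h :: hs) f (k + x) - diff (h :: hs) f x.
  by rewrite /= addrCA !opprB addrACA [in RHS]addrACA [- _ + _]addrC.
by rewrite !IH.
Qed.

Lemma diff_affine {R : pzRingType} {G : lmodType R} {H : zmodType}
    (hs : seq R) (f : G -> H) (v x : G) (s : R) :
  diff hs (fun r => f (r *: v + x)) s = diff [seq h *: v | h <- hs] f (s *: v + x).
Proof.
by elim: hs s => [//|h hs IH] s /=; rewrite !IH scalerDl addrA.
Qed.

(** Each unit-step difference lowers the degree by one and multiplies the leading coefficient by the
    old degree. *)
Lemma diff_expr {R : comPzRingType} (n k : nat) (x : R) : (k <= n)%N ->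
  diff (nseq n 1) (fun r : R => r ^+ k) x = ((k == n) * n`!)%:R.
Proof.
elim: n k x => [|n IH] k x; first by rewrite leqn0 => /eqP ->.
move=> kn; rewrite diff_swap.
(* In $(1+z)^k-z^k$ the top term of the binomial expansion cancels. *)
transitivity (diff (nseq n 1)
    (fun z : R => \sum_(i < k) ('C(k, i)%:R : R) *: (z ^+ i : R^o)) x).
  apply: eq_diff => z.
  rewrite exprDn big_ord_recr /= subnn expr0 mul1r binn mulr1n addrK.
  by apply: eq_bigr => i _; rewrite expr1n mul1r -mulr_natl.
rewrite (@diff_sum _ _ R^o) (eq_bigr (fun i : 'I_k =>
  'C(k, i)%:R * ((i == n :> nat) * n`!)%:R)); last first.
  by move=> i _; rewrite IH// -ltnS (leq_trans _ kn).
(* If [k] is [n.+1], only the index [i = n] survives and contributes $(n+1)\,n!$; otherwise every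
   [i] is below [n] and all terms vanish. *)
move: kn; rewrite leq_eqVlt => /predU1P[->|kn].
  rewrite big_ord_recr /= big1 ?add0r.
    by rewrite !eqxx !mul1n binSn -natrM factS.
  by move=> i _; rewrite ltn_eqF//= mul0n mulr0.
rewrite big1 => [|i _]; first by rewrite ltn_eqF.
have lt_in : (i < n)%N := leq_trans (ltn_ord i) kn.
by rewrite (ltn_eqF lt_in) /= mul0n mulr0.
Qed.

Lemma sum_mask_nseq {R : pzRingType} (n : nat) (h : R) (m : bitseq) :
  m \in masks n -> \sum_(y <- mask m (nseq n h)) y = (count id m)%:R * h.
Proof.
elim: n m => [|n IH] m /=.
  by rewrite mem_seq1 => /eqP ->; rewrite big_nil mul0r.
rewrite mem_cat => /orP[] /mapP[m' m'n ->] /=; last by rewrite IH.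
by rewrite big_cons IH// natrD mulrDl mul1r.
Qed.

End FiniteDifferences.

(** * Boxes spanned by a list of directions *)

Section Box.
Context {R : realType} {X : tvsType R}.
Implicit Types (t : R) (ys : seq X) (K : set X).

(** The points $z+\sum_i s_iy_i$ with $z\in K$ and $0\le s_i\le t$. The nesting matches the
    recursion of [diff]. *)
Fixpoint box t ys K : set X :=
  if ys is y :: ys' then
    box t ys' ((fun p : R * X => p.1 *: y + p.2) @` (`[0, t] `*` K))
  else K.

Lemma box_compact t ys K : compact K -> compact (box t ys K).
Proof.
elim: ys K => [//|y ys IH] K cK /=; apply: IH.
apply: continuous_compact.
  apply: continuous_subspaceT => p; apply: tvs_cvgD; last exact: cvg_snd.
  by apply: tvs_cvgZ; [exact: cvg_fst|exact: cvg_cst].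
exact/compact_setX/cK/segment_compact.
Qed.

Lemma box_subset t t' ys K K' : t <= t' -> K `<=` K' ->
  box t ys K `<=` box t' ys K'.
Proof.
move=> tt'; elim: ys K K' => [//|y ys IH] K K' KK' /=; apply: IH.
move=> _ [[s z] /= [+ Kz] <-]; rewrite in_itv /= => /andP[s0 st].
exists (s, z) => //; split => /=; last exact: KK'.
by rewrite in_itv /= s0 (le_trans st).
Qed.

Lemma box_cons t y ys (x : X) s : 0 <= s <= t ->
  box t ys [set s *: y + x] `<=` box t (y :: ys) [set x].
Proof.
move=> st; apply: box_subset => // _ ->; exists (s, x) => //=.
Qed.

Lemma box_center t ys x : 0 <= t -> box t ys [set x] x.
Proof.
move=> t0; elim: ys => [//|y ys IH]; apply: (@box_cons _ _ _ _ 0).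
  by rewrite lexx.
by rewrite scale0r add0r.
Qed.

Lemma box_small ys (x : X) (W : set X) : nbhs x W ->
  exists2 t, 0 < t & box t ys [set x] `<=` W.
Proof.
(* The first direction already thickens the point [x], so the induction needs a whole neighbourhood
   [N] as base. *)
move=> xW; suff [t [N [t0 xN tN]]] : exists t N,
    [/\ 0 < t, nbhs x N & box t ys N `<=` W].
  exists t => //; apply: subset_trans tN; apply: box_subset => // _ ->.
  exact: nbhs_singleton.
elim: ys => [|y ys [t [N [t0 xN tN]]]]; first by exists 1, W; split.
have : (fun p : R * X => p.1 *: y + p.2) @ nbhs ((0 : R), x) --> x.
  rewrite -{2}[x]add0r -(scale0r y); apply: tvs_cvgD; last exact: cvg_snd.
  by apply: tvs_cvgZ; [exact: cvg_fst|exact: cvg_cst].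
move=> /(_ N xN) [[A B] /= [[d /= d0 dA] xB] AB].
have d20 : 0 < d / 2 by rewrite divr_gt0.
exists (Num.min t (d / 2)), B; split => //.
  by rewrite lt_min t0.
apply: subset_trans tN; apply: box_subset; first by rewrite ge_min lexx.
move=> _ [[s z] /= [+ Bz] <-]; rewrite in_itv /= le_min => /and3P[s0 _ sd].
apply: (AB (s, z)); split => //=; apply: dA.
rewrite /= sub0r normrN ger0_norm// (le_lt_trans sd)// ltr_pdivrMr// ltr_pMr//.
by rewrite ltr1n.
Qed.

End Box.

(** * Convergence of difference quotients, and polarization *)

Section Polarization.
Context {R : realType} {X V : tvsType R}.
Implicit Types (f : X -> V) (ys : seq X).

(** Differencing and differentiating commute as long as [f] is differentiable at all vertices
    involved; these lie in the box. *)
Lemma is_dir_derive_diff (U : set X) f (y : X) t ys z : 0 <= t ->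
  (forall x, U x -> exists l, is_dir_derive f y x l) ->
  box t ys [set z] `<=` U ->
  is_dir_derive (diff [seq t *: v | v <- ys] f) y z
    (diff [seq t *: v | v <- ys] (dir_derive f y) z).
Proof.
move=> t0 ex; elim: ys z => [|v ys IH] z zU /=.
  by apply/dir_deriveP/ex/zU.
apply: is_dir_deriveB; last first.
  apply: IH; apply: subset_trans zU; rewrite -{1}[z]add0r -(scale0r v).
  by apply: box_cons; rewrite lexx.
have sub : box t ys [set t *: v + z] `<=` U.
  by apply: subset_trans zU; apply: box_cons; rewrite t0 lexx.
apply: cvg_trans (IH _ sub); apply: near_eq_cvg; apply: filterE => h /=.
by rewrite addrCA.
Qed.

(** The mean value theorem is applied one direction at a time: the outermost difference is that of
    [phi] between [0] and [t], and the derivative of [phi] is a lower-order quotient of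
    [dir_derive f y], in [C] by induction. *)
Lemma diff_mean_value (U : set X) f ys (C : set V) (t : R) (x : X) :
  0 < t -> open C -> is_convex C ->
  iter_dir_derivable U f ys -> box t ys [set x] `<=` U ->
  (forall z, box t ys [set x] z -> C (iter_dir_derive f ys z)) ->
  C (t^-1 ^+ size ys *: diff [seq t *: v | v <- ys] f x).
Proof.
move=> t0; elim: ys f C x => [|y ys IH] f C x oC cC /=.
  by move=> _ _ fC; rewrite expr0 scale1r; exact: fC.
move=> [ex df] xU fC.
pose phi s := t^-1 ^+ size ys *: diff [seq t *: v | v <- ys] f (s *: y + x).
pose dphi s := t^-1 ^+ size ys *:
  diff [seq t *: v | v <- ys] (dir_derive f y) (s *: y + x).
suff : C (t^-1 *: (phi t - phi 0)).
  by rewrite /phi scale0r add0r -scalerBr scalerA -exprS.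
apply: (@mean_value_convex _ _ phi dphi) => // s st.
have sub : box t ys [set s *: y + x] `<=` box t (y :: ys) [set x].
  exact: box_cons.
split; last first.
  by apply: IH => // [z /sub/xU|z /sub/fC].
have := is_dir_derive_diff (ltW t0) ex (subset_trans sub xU).
rewrite /is_dir_derive => /(tvs_cvgZl (k := t^-1 ^+ size ys)).
apply: cvg_trans; apply: near_eq_cvg; apply: filterE => h /=.
by rewrite /phi -scalerBr !scalerA mulrC scalerDl addrA.
Qed.

(** On a small box the derivative takes values in a given convex neighbourhood of its value at [x];
    by [diff_mean_value] so do the quotients. *)
Lemma diff_quotient_cvg (U : set X) f ys (x : X) : open U -> U x ->
  iter_dir_derivable U f ys ->
  (forall K, compact K -> K `<=` U ->
    {within K, continuous (iter_dir_derive f ys)}) ->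
  t^-1 ^+ size ys *: diff [seq t *: v | v <- ys] f x @[t --> 0^'+] -->
    iter_dir_derive f ys x.
Proof.
move=> oU Ux df cf W /= /nbhs_open_convex[C [oC cC Cx CW]].
have [d d0 dU] := box_small ys (open_nbhs_nbhs (conj oU Ux)).
(* Continuity is given on compact sets only, so it is used relative to the box of size [d]; hence
   [t] must stay below both [d] and [e]. *)
have /subspace_continuousP/(_ x) := cf _ (box_compact (@compact_set1 X x)) dU.
move=> /(_ (box_center _ _ (ltW d0)) C (open_nbhs_nbhs (conj oC Cx))).
rewrite /= nbhs_filterE /= => /(box_small ys)[e e0 eC].
have de0 : 0 < Num.min d e by rewrite lt_min d0.
rewrite nbhs_filterE /=.
near=> t.
have t0 : 0 < t by near: t; exact: nbhs_right_gt.
have : t < Num.min d e by near: t; exact: nbhs_right_lt.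
rewrite lt_min => /andP[/ltW td /ltW te].
apply: CW; apply: (diff_mean_value t0 oC cC df).
  by apply: subset_trans dU; exact: box_subset.
by move=> z tz; apply: eC; [exact: box_subset tz|exact: box_subset tz].
Unshelve. all: by end_near. Qed.

(* With [nu t] the difference of [f] in the directions [t *: ys], the [j]-th
   difference of [nu] at [0] with step [h] is computed in two ways. *)
Lemma polarization (U : set X) f (ys : seq X) (x : X) :
  hausdorff_space V -> open U -> U x ->
  (forall zs, size zs = size ys -> iter_dir_derivable U f zs) ->
  (forall zs K, size zs = size ys -> compact K -> K `<=` U ->
    {within K, continuous (iter_dir_derive f zs)}) ->
  (size ys)`!%:R *: iter_dir_derive f ys x =
  \sum_(m <- masks (size ys)) (-1) ^+ count negb m *:
    iter_dir_derive f (nseq (size ys) (\sum_(y <- mask m ys) y)) x.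
Proof.
move=> hV oU Ux df cf; set j := size ys.
pose nu (t : R) := diff [seq t *: v | v <- ys] f x.
have nuE t : nu t = \sum_(m <- masks j) (-1) ^+ count negb m *:
    f (t *: (\sum_(y <- mask m ys) y) + x).
  rewrite /nu diffE size_map; apply: eq_bigr => m _.
  by rewrite -map_mask big_map scaler_sumr.
have hquot zs : size zs = j ->
    t^-1 ^+ j *: diff [seq t *: v | v <- zs] f x @[t --> 0^'+] -->
    iter_dir_derive f zs x.
  move=> szs; rewrite -{1}szs; apply: (diff_quotient_cvg oU Ux).
    exact: df.
  by move=> K; exact: cf.
(* First computation: each term of [nuE] varies along a line, so its difference is one of [f] in a
   single repeated direction. *)
have lim1 : t^-1 ^+ j *: diff (nseq j t) nu 0 @[t --> 0^'+] -->
    \sum_(m <- masks j) (-1) ^+ count negb m *: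
      iter_dir_derive f (nseq j (\sum_(y <- mask m ys) y)) x.
  apply: (@cvg_trans _ (\sum_(m <- masks j) (-1) ^+ count negb m *: (t^-1 ^+ j *:
      diff [seq t *: v | v <- nseq j (\sum_(y <- mask m ys) y)] f x)
      @[t --> 0^'+])); last first.
    by apply: tvs_cvg_sum => m; apply/tvs_cvgZl/hquot; rewrite size_nseq.
  apply: near_eq_cvg; apply: filterE => t.
  rewrite (eq_diff _ _ nuE) (diff_sum _ _ (fun m (r : R) =>
    f (r *: (\sum_(y <- mask m ys) y) + x))) scaler_sumr.
  apply: eq_bigr => m _; rewrite diff_affine scale0r add0r !map_nseq.
  by rewrite !scalerA mulrC.
(* For [k = 0] both sides vanish when [j > 0], and [0 ^+ 0 = 1] settles [j = 0]; for [k > 0] the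
   variable is rescaled. *)
have limk (k : nat) : t^-1 ^+ j *: nu (k%:R * t) @[t --> 0^'+] -->
    k%:R ^+ j *: iter_dir_derive f ys x.
  case: k => [|k].
    apply: cvg_near_cst; apply: filterE => t.
    rewrite mul0r /nu /j; case: (ys) => [|y ys'] /=; first by rewrite !expr0.
    by rewrite scale0r add0r subrr scaler0 exprS mul0r scale0r.
  have k0 : 0 < k.+1%:R :> R by rewrite ltr0n.
  apply: (@cvg_trans _ (k.+1%:R ^+ j *: ((k.+1%:R * t)^-1 ^+ j *: nu (k.+1%:R * t))
      @[t --> 0^'+])).
    apply: near_eq_cvg; near=> t.
    have t0 : t != 0 by near: t; exact: nbhs_right_neq.
    by rewrite scalerA -exprMn invfM mulrA divff ?mul1r// gt_eqF.
  apply: tvs_cvgZl.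
  apply: (@cvg_comp _ _ _ (fun t : R => k.+1%:R * t)
    (fun t => t^-1 ^+ j *: nu t) _ 0^'+); last exact: hquot.
  move=> W [d /= d0 dW]; exists (d / k.+1%:R); first by rewrite /= divr_gt0.
  move=> t /=; rewrite sub0r normrN => td t0; apply: dW; last by rewrite mulr_gt0.
  by rewrite /= sub0r normrN normrM (gtr0_norm k0) mulrC -ltr_pdivlMr.
(* Second computation: the outer difference is a signed sum of values [nu (k%:R * t)], and the
   coefficients of the limits add up to the [j]-th unit difference of [r ^+ j] at [0], a
   factorial. *)
have lim2 : t^-1 ^+ j *: diff (nseq j t) nu 0 @[t --> 0^'+] -->
    j`!%:R *: iter_dir_derive f ys x.
  have -> : j`!%:R = \sum_(m <- masks j)
      (-1) ^+ count negb m * (count id m)%:R ^+ j :> R.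
    have /esym := diff_expr (0 : R) (leqnn j); rewrite eqxx mul1n => ->.
    rewrite (@diffE _ _ R^o) size_nseq; apply: eq_big_seq => m mj.
    by rewrite sum_mask_nseq// mulr1 addr0.
  rewrite scaler_suml.
  apply: (@cvg_trans _ (\sum_(m <- masks j) (-1) ^+ count negb m *: (t^-1 ^+ j *:
      nu ((count id m)%:R * t)) @[t --> 0^'+])); last first.
    by apply: tvs_cvg_sum => m; rewrite -scalerA; apply/tvs_cvgZl/limk.
  apply: near_eq_cvg; apply: filterE => t.
  rewrite diffE size_nseq scaler_sumr; apply: eq_big_seq => m mj.
  by rewrite !scalerA mulrC sum_mask_nseq// addr0.
exact: (cvg_unique hV lim2 lim1).
Unshelve. all: by end_near. Qed.

End Polarization.

(** * Continuity on products, subspaces and $k_{\mathbb{R}}$-spaces *)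

Lemma cvg_pair_nbhs {T : Type} {X Y : topologicalType} {Fil : set_system T}
    {FF : Filter Fil} (f : T -> X) (g : T -> Y) (x : X) (y : Y) :
  f @ Fil --> x -> g @ Fil --> y -> (fun t => (f t, g t)) @ Fil --> (x, y).
Proof. exact: cvg_pair. Qed.

Lemma cvg_ptws {I : eqType} {X : topologicalType} {T : Type}
    {Fil : set_system T} {FF : Filter Fil} (f : T -> {ptws I -> X})
    (y : {ptws I -> X}) :
  (forall i, (fun t => f t i) @ Fil --> y i) -> f @ Fil --> y.
Proof.
move=> fy; apply/cvg_sup => i W /= [_ [[Q oQ <-] Oy] OW].
by apply: filterS OW _; apply: (fy i); exact: open_nbhs_nbhs.
Qed.

Section WithinProduct.
Context {X Y W : topologicalType} (A : set X).

(** Translates relative continuity into continuity on [set_type A * Y], the kind of space to which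
    the $k_{\mathbb{R}}$-hypothesis refers. *)
Lemma set_typeM_continuous (G : X * Y -> W) :
  {within A `*` [set: Y], continuous G} <->
  continuous (fun z : set_type A * Y => G (set_val z.1, z.2)).
Proof.
split=> [/subspace_continuousP cG [a v] | cG].
  apply: (@cvg_comp _ _ _ (fun z : set_type A * Y => (set_val z.1, z.2)) G
    _ (within (A `*` [set: Y]) (nbhs (set_val a, v)))); last first.
    by apply: cG; split => //=; exact: set_valP.
  move=> B /=; rewrite withinE => -[B' [[P Q] /= [aP vQ] PQ] BB'].
  exists (set_val @^-1` P, Q) => /=.
    by split => //; exact: (@initial_continuous _ X set_val).
  move=> [a' v'] /= [Pa' Qv'].
  have : (B' `&` A `*` [set: Y]) (set_val a', v').
    by split; [exact: PQ|split => //=; exact: set_valP].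
  by rewrite -BB' => -[].
apply/subspace_continuousP => -[x v] [/= Ax _] B GB.
have := cG (SigSub (mem_set Ax), v) B GB.
move=> [[P Q] /= [[_ [[N1 oN <-] Ox] OP] vQ] PQ].
change (nbhs (x, v) [set p | (A `*` [set: Y]) p -> B (G p)]).
exists (N1, Q) => /=; first by split => //; exact: open_nbhs_nbhs.
move=> [x' v'] /= [Ox' Qv'] [/= Ax' _].
by apply: (PQ (SigSub (mem_set Ax'), v')); split => //=; exact: OP.
Qed.

End WithinProduct.

Lemma within_comp {X Y Z : topologicalType} (A : set X) (B : set Y)
    (f : X -> Y) (g : Y -> Z) :
  (forall x, A x -> B (f x)) -> continuous f -> {within B, continuous g} ->
  {within A, continuous (g \o f)}.
Proof.
move=> AB cf /subspace_continuousP cg; apply/subspace_continuousP => x Ax.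
apply: (@cvg_comp _ _ _ f g _ (within B (nbhs (f x)))); last exact/cg/AB.
move=> W /= BW; change (nbhs x [set z | A z -> W (f z)]).
have : nbhs x (f @^-1` [set y | B y -> W y]) by exact: cf.
by apply: filterS => z /= Wz Az; exact/Wz/AB.
Qed.

(* Composition with Urysohn functions reduces to the real-valued case. *)
Lemma kR_space_uniform {R : realType} {Z : topologicalType} {W : uniformType}
    (f : Z -> W) :
  kR_space R Z -> (forall K, compact K -> {within K, continuous f}) ->
  continuous f.
Proof.
move=> [_ kR] cf z B; rewrite nbhsE => -[Q [oQ Qf] OB].
have /(@uniform_separatorP _ R)[u [cu _ u0 u1]] :=
  @uniform_completely_regular R W (f z) (~` Q) (open_closedC oQ) (fun h => h Qf).
have cuf : continuous (u \o f).
  apply: kR => K cK x; apply: (@continuous_comp (subspace K) W R f u); [exact: (cf K cK)|exact: cu].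
have ufz : u (f z) < 1.
  by have -> : u (f z) = 0; [apply: u0; exists (f z)|exact: ltr01].
have : nbhs z ((u \o f) @^-1` [set r | r < 1]).
  by apply: cuf; apply: open_nbhs_nbhs; split; [exact: open_lt|].
apply: filterS => w /= uw; apply: OB.
apply: contrapT => nO; have : u (f w) = 1 by apply: (u1 (u (f w))); exists (f w).
by move=> uw1; move: uw; rewrite /= uw1 ltxx.
Qed.

(** * $C^\ell$-maps and the diagonals of their derivatives *)

Section Proposition.
Context {R : realType} {E F X : tvsType R}.
Implicit Types (A : set X) (ell : option nat).

(** [within_eval] gives continuity on compact sets, and the $k_{\mathbb{R}}$-property makes it
    global. *)
Lemma kR_within_eval A (G : X * X -> cont_linear_map E F) (H : X * X -> E) :
  kR_space R (set_type A * X)%type ->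
  {within A `*` [set: X], continuous G} ->
  {within A `*` [set: X], continuous H} ->
  {within A `*` [set: X], continuous (fun p => G p (H p))}.
Proof.
move=> kRA /set_typeM_continuous cG /set_typeM_continuous cH.
apply/set_typeM_continuous.
apply: (kR_space_uniform kRA) => K cK.
apply: (@within_eval _ _ _ _ K (fun z : set_type A * X => G (set_val z.1, z.2))
  (fun z : set_type A * X => H (set_val z.1, z.2))) => //;
  exact: continuous_subspaceT.
Qed.

Lemma le_order_trans ell m n : (m <= n)%N -> le_order n ell -> le_order m ell.
Proof. by case: ell => [l|] //=; exact: leq_trans. Qed.

Lemma codom_nth_ord {T : Type} (x0 : T) (s : seq T) :
  codom (fun i : 'I_(size s) => nth x0 s i) = s.
Proof.
rewrite codomE (map_comp (nth x0 s) val) val_enum_ord.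
by rewrite map_nth_iota0// take_size.
Qed.

Section CMap.
Context {Y : preTopologicalLmodType R}.
Implicit Type (f : X -> Y).

(** The directions are frozen in the extension [g]; at interior points of [A] relative continuity is
    ordinary continuity. *)
Lemma C_map_smooth_on ell A f n :
  C_map ell A f -> le_order n ell -> smooth_on A° n f.
Proof.
move=> [_ Cf] ne zs zsn.
have [ex [g [cg gE]]] := Cf _ (le_order_trans zsn ne).
pose y : {ptws 'I_(size zs) -> X} := fun i => nth 0 zs i.
have yE : codom y = zs by exact: codom_nth_ord.
split; first by rewrite -yE; exact: ex.
move=> x Ax; have cgy : {within A, continuous (g \o (fun x => (x, y)))}.
  apply: (within_comp _ _ cg) => [x' Ax'|x']; first by split.
  apply: cvg_pair_nbhs; [exact: cvg_id|exact: cvg_cst].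
have {}cgy : (g \o (fun x => (x, y))) @ nbhs x --> g (x, y).
  move/subspace_continuousP: cgy => /(_ x (interior_subset Ax)).
  by rewrite within_interior.
suff : iter_dir_derive f zs @ nbhs x --> iter_dir_derive f zs x by [].
rewrite (_ : iter_dir_derive f zs x = g (x, y)); last first.
  by rewrite gE// yE.
apply: cvg_trans cgy.
apply: near_eq_cvg; have := nbhs_interior Ax; apply: filterS => x' Ax' /=.
by rewrite gE// yE.
Qed.

(** Pulling the extension back along [v |-> (v, .., v)] brings it to [A * X], where the
    $k_{\mathbb{R}}$-hypothesis applies. *)
Lemma C_map_diag ell A f n : C_map ell A f -> le_order n ell ->
  exists G : X * X -> Y, {within A `*` [set: X], continuous G} /\
    forall x v, A° x -> G (x, v) = iter_dir_derive f (nseq n v) x.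
Proof.
move=> [_ Cf] ne; have [_ [g [cg gE]]] := Cf _ ne.
exists (g \o (fun p => (p.1, (fun=> p.2) : {ptws 'I_n -> X}))); split.
  apply: (within_comp _ _ cg); first by move=> p [].
  move=> p; apply: cvg_pair_nbhs; first exact: cvg_fst.
  by apply: cvg_ptws => i; exact: cvg_snd.
move=> x v Ax /=; rewrite gE//; congr iter_dir_derive.
by rewrite codomE -[n in nseq n _]size_enum_ord; elim: (enum _) => //= i s ->.
Qed.

Lemma C_map_diag_choice ell A f : C_map ell A f ->
  exists G : nat -> X * X -> Y, forall a, le_order a ell ->
    {within A `*` [set: X], continuous (G a)} /\
    forall x v, A° x -> G a (x, v) = iter_dir_derive f (nseq a v) x.
Proof.
move=> Cf; have /choice[G GP] a : exists Ga : X * X -> Y, le_order a ell ->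
    {within A `*` [set: X], continuous Ga} /\
    forall x v, A° x -> Ga (x, v) = iter_dir_derive f (nseq a v) x.
  have [/(C_map_diag Cf)[Ga GaP]|_] := boolP (le_order a ell); first by exists Ga.
  (* Default value for orders above [ell]. *)
  by exists (fun=> 0).
by exists G.
Qed.

End CMap.

(* [leibniz_sum] along [(v, .., v)], with [G a] and [H b] standing for the
   continuous extensions to [A * X] of the derivatives of orders [a] and [b]. *)
Fixpoint diag_sum (G : nat -> X * X -> cont_linear_map E F)
    (H : nat -> X * X -> E) (a b n : nat) (p : X * X) : F :=
  if n is n'.+1 then diag_sum G H a.+1 b n' p + diag_sum G H a b.+1 n' p
  else G a p (H b p).

Section DiagSum.
Variables (ell : option nat) (A : set X).
Variables (gamma : X -> cont_linear_map E F) (eta : X -> E).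
Variables (G : nat -> X * X -> cont_linear_map E F) (H : nat -> X * X -> E).
Hypothesis GE : forall a x v, le_order a ell -> A° x ->
  G a (x, v) = iter_dir_derive gamma (nseq a v) x.
Hypothesis HE : forall a x v, le_order a ell -> A° x ->
  H a (x, v) = iter_dir_derive eta (nseq a v) x.
Hypothesis cG : forall a, le_order a ell ->
  {within A `*` [set: X], continuous (G a)}.
Hypothesis cH : forall a, le_order a ell ->
  {within A `*` [set: X], continuous (H a)}.

Lemma iter_dir_derive_nseqS {Y : preTopologicalLmodType R} (f : X -> Y) v n :
  iter_dir_derive f (nseq n.+1 v) = dir_derive (iter_dir_derive f (nseq n v)) v.
Proof. by rewrite -iter_dir_derive_rcons -cats1 -[[:: v]]/(nseq 1 v) -nseqD addn1. Qed.

(** [a] and [b] count the copies of [v] already spent on [gamma] and [eta], and [n] those left;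
    [a + b + n] is invariant, so the bound by [ell] persists. *)
Lemma diag_sumE a b n x v : le_order (a + b + n) ell -> A° x ->
  diag_sum G H a b n (x, v) = leibniz_sum (iter_dir_derive gamma (nseq a v))
    (iter_dir_derive eta (nseq b v)) (nseq n v) x.
Proof.
elim: n a b => [|n IH] a b abn Ax /=.
  rewrite GE ?HE//; apply: le_order_trans abn; rewrite addn0.
    exact: leq_addl.
  exact: leq_addr.
rewrite !IH// ?addSnnS ?addnS ?addSn//; last 2 first.
- by move: abn; rewrite addnS.
- by move: abn; rewrite addnS.
by rewrite !iter_dir_derive_nseqS.
Qed.

Lemma diag_sum_continuous a b n : kR_space R (set_type A * X)%type ->
  le_order (a + b + n) ell ->
  {within A `*` [set: X], continuous (diag_sum G H a b n)}.
Proof.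
move=> kRA; elim: n a b => [|n IH] a b abn.
  apply: kR_within_eval => //; [apply: cG|apply: cH];
    apply: le_order_trans abn; rewrite addn0; [exact: leq_addr|exact: leq_addl].
move=> p; apply: tvs_cvgD; apply: IH; move: abn;
  by rewrite addnS ?addSn ?addnS.
Qed.

End DiagSum.

End Proposition.

Theorem proposition1p16 (R : realType) (E F X : tvsType R)
    (hE : hausdorff_space E) (hF : hausdorff_space F) (hX : hausdorff_space X)
    (ell : option nat) (A : set X) (regA : regular_set A)
    (gamma : X -> cont_linear_map E F) (Cgamma : C_map ell A gamma)
    (eta : X -> E) (Ceta : C_map ell A eta)
    (kRA : kR_space R (set_type A * X)%type) :
  C_map ell A (fun x => gamma x (eta x)).
Proof.
have cfst (Y : topologicalType) (f : X -> Y) : {within A, continuous f} ->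
    {within A `*` [set: X], continuous (f \o fst)}.
  by apply: within_comp => [p []//|p]; exact: cvg_fst.
split.
  (* Order zero: both maps are made constant in a second variable, and the result is restricted to
     the slice where that variable is [0]. *)
  have := kR_within_eval kRA (cfst _ _ Cgamma.1) (cfst _ _ Ceta.1).
  apply: (@within_comp _ _ _ A _ (fun x => (x, 0))) => // x.
  by apply: cvg_pair_nbhs; [exact: cvg_id|exact: cvg_cst].
have oA : open A° by exact: open_interior.
have [G GP] := C_map_diag_choice Cgamma.
have [H HP] := C_map_diag_choice Ceta.
move=> j jl; set f := fun x => gamma x (eta x).
have leib zs : size zs = j -> iter_dir_derivable A° f zs /\
    forall x, A° x -> iter_dir_derive f zs x = leibniz_sum gamma eta zs x.
  by move=> szs; apply: leibniz => //; rewrite szs;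
    [exact: C_map_smooth_on Cgamma jl|exact: C_map_smooth_on Ceta jl].
split; first by move=> y; apply: (leib _ _).1; rewrite size_codom card_ord.
(* The continuous extension of the diagonal $(x,v)\mapsto d^{(j)}f(x,v,\ldots,v)$. *)
pose delta := diag_sum G H 0 0 j.
have cdelta : {within A `*` [set: X], continuous delta}.
  by apply: (@diag_sum_continuous _ _ _ _ ell) => // a /[dup] ? => [/GP[]|/HP[]].
have deltaE x v : A° x -> delta (x, v) = iter_dir_derive f (nseq j v) x.
  move=> Ax; rewrite (leib _ _).2 ?size_nseq//.
  by apply: (@diag_sumE _ _ _ _ ell A) => // a x' v' al Ax';
    [rewrite (GP a al).2|rewrite (HP a al).2].
pose vsum (m : bitseq) (y : {ptws 'I_j -> X}) := \sum_(z <- mask m (codom y)) z.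
have cvsum m : continuous (vsum m).
  rewrite (_ : vsum m = fun y => \sum_(i <- mask m (enum 'I_j)) y i); last first.
    by apply/funext => y; rewrite /vsum codomE -map_mask big_map.
  move=> y; apply: (@tvs_cvg_sum _ _ _ _ (nbhs_filter y) _ _
    (fun i (z : {ptws 'I_j -> X}) => z i)) => i.
  exact: (@proj_continuous _ (fun=> X)).
(* The polarization formula solved for the derivative, with [delta] in place of the diagonal
   values. *)
exists (fun p => j`!%:R^-1 *: \sum_(m <- masks j)
  (-1) ^+ count negb m *: delta (p.1, vsum m p.2)); split.
  move=> p; apply: tvs_cvgZl; apply: tvs_cvg_sum => m; apply: tvs_cvgZl.
  move: p; apply: (@within_comp _ _ _ _ _ (fun p => (p.1, vsum m p.2)) _ _ _ cdelta).
    by move=> p [].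
  move=> p; apply: cvg_pair_nbhs; first exact: cvg_fst.
  by apply: (cvg_comp _ _ cvg_snd); exact: cvsum.
move=> x y Ax /=.
have sy : size (codom y) = j by rewrite size_codom card_ord.
apply: (@scalerI _ _ (j`!%:R : R)).
  by rewrite pnatr_eq0 -lt0n fact_gt0.
rewrite scalerA divff ?scale1r; last by rewrite pnatr_eq0 -lt0n fact_gt0.
have := @polarization R X F A° f (codom y) x hF oA Ax; rewrite sy => ->.
- by apply: eq_bigr => m _; rewrite deltaE.
- by move=> zs /leib[].
(* On compact subsets of the interior the derivative equals the Leibniz sum, which is continuous
   there. *)
- move=> zs K szs cK KA; apply: (@subspace_eq_continuous _ _ _ (leibniz_sum gamma eta zs)).
    by move=> z; rewrite inE => /KA Az; exact: (esym ((leib _ szs).2 z Az)).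
  by apply: (leibniz_sum_continuous _ _ cK KA); rewrite szs;
    [exact: C_map_smooth_on Cgamma jl|exact: C_map_smooth_on Ceta jl].
Qed.
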